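(* Let $\Omega\subset\mathbb{R}^n$ be a smooth bounded domain and let $p$ be a weight as in the context, with minimum value $p_0$. Suppose that one of the following holds: $n=3$ and $s\in(0,\tfrac14]$; or $n=4$ and $s\in(0,\tfrac12]$; or $n=5$ and $s\in(0,\tfrac34]$; or $n\ge 6$ and $s\in(0,1)$. Then for all $k\in[2,n-4s)$ (where $k$ is the exponent in the growth condition on $p$) we have $$S_{s,0}(p)=p_0\,S_{s,0}(1),$$ and the problem $$\int_{\mathbb{R}^n\times\mathbb{R}^n}p(x)\frac{(u(x)-u(y))(\varphi(x)-\varphi(y))}{|x-y|^{n+2s}}\,dx\,dy=\int_\Omega |u(x)|^{q_s-2}u(x)\varphi(x)\,dx\qquad\text{for all }\varphi\in\mathbb{H}^s_0(\Omega)$$ has no minimizing solution, i.e. the infimum $S_{s,0}(p)$ is not attained by any $u\in\mathbb{H}^s_0(\Omega)$ with $\|u\|_{L^{q_s}(\mathbb{R}^n)}=1$.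
   Context: Here $q_s:=\frac{2n}{n-2s}$. The space $\mathbb{H}^s_0(\Omega)$ is the set of real-valued $u\in H^s(\mathbb{R}^n)$ (that is, $u\in L^2(\mathbb{R}^n)$ and $\int_{\mathbb{R}^n\times\mathbb{R}^n}\frac{|u(x)-u(y)|^2}{|x-y|^{n+2s}}dx\,dy<\infty$) with $u=0$ a.e. in $\mathbb{R}^n\setminus\Omega$. The weight $p:\mathbb{R}^n\to\mathbb{R}$ is positive and continuous, has a global positive minimum $p_0=p(a)>0$ at a point $a\in\Omega$, satisfies $p(x)\le p_0+\kappa|x-a|^k$ for $x\in B(a,4\eta)$, where $\eta>0$ is such that $B(a,4\eta)\subset\Omega$, $\kappa>0$ and $k>1$, and satisfies $p-p_0\in L^1(\mathbb{R}^n)$. For a weight $p$ (or $p$ replaced by the constant $1$), $$S_{s,0}(p):=\inf\left\{\int_{\mathbb{R}^n}p(x)\left(\int_{\mathbb{R}^n}\frac{|u(x)-u(y)|^2}{|x-y|^{n+2s}}dy\right)dx:\ u\in\mathbb{H}^s_0(\Omega),\ \|u\|_{L^{q_s}(\mathbb{R}^n)}=1\right\}.$$ *)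

(* Defs.v *)
From HB Require Import structures.
From mathcomp Require Import all_boot all_order all_algebra.
From mathcomp Require Import all_classical all_reals all_analysis.

Set Implicit Arguments.
Unset Strict Implicit.
Unset Printing Implicit Defensive.

Import Order.TTheory GRing.Theory Num.Theory.
Import numFieldNormedType.Exports.

Local Open Scope classical_set_scope.
Local Open Scope ring_scope.

(* The sigma-algebra on R^n is generated by the coordinates, as the library
   does for tuples; it is the Borel sigma-algebra of R^n. *)
Definition rV_display : measure_display. Proof. exact: default_measure_display. Qed.

Section measurable_rV.
Context {R : realType} {n : nat}.

Let coord : 'I_n -> 'rV[R]_n -> measurableTypeR R := fun i x => x ord0 i.

Let rV_set0 : g_sigma_preimage coord set0.
Proof. exact: sigma_algebra0. Qed.

Let rV_setC A : g_sigma_preimage coord A -> g_sigma_preimage coord (~` A).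
Proof. exact: sigma_algebraC. Qed.

Let rV_bigcup (F : (set 'rV[R]_n)^nat) :
  (forall i, g_sigma_preimage coord (F i)) ->
  g_sigma_preimage coord (\bigcup_i (F i)).
Proof. exact: sigma_algebra_bigcup. Qed.

HB.instance Definition _ := @isMeasurable.Build rV_display
  'rV[R]_n (g_sigma_preimage coord) rV_set0 rV_setC rV_bigcup.

End measurable_rV.

Lemma measurable_coord (R : realType) (n : nat) (i : 'I_n) :
  measurable_fun [set: 'rV[R]_n] (fun x => x ord0 i : measurableTypeR R).
Proof.
move=> _ Y mY; rewrite setTI; apply: sub_sigma_algebra => /=.
rewrite -bigcup_seq/=; exists i => /=; first by rewrite mem_index_enum.
by exists Y => //; rewrite setTI.
Qed.

Lemma measurable_fun_coordP (R : realType) (n : nat) d (T : measurableType d)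
    (f : T -> 'rV[R]_n) :
  (forall i, measurable_fun [set: T] (fun t => f t ord0 i : measurableTypeR R)) ->
  measurable_fun [set: T] f.
Proof.
move=> mf _ Y; rewrite setTI => mY.
have := mY; rewrite /measurable/=.
apply: (@smallest_sub _ (sigma_algebra setT)
  (\big[setU/set0]_(i < n) preimage_set_system setT
     (fun x : 'rV[R]_n => x ord0 i : measurableTypeR R) measurable)
  [set A | measurable (f @^-1` A)]).
- split => /=.
  + by rewrite preimage_set0; exact: measurable0.
  + by move=> A mA; rewrite setTD preimage_setC; exact: measurableC.
  + by move=> F mF; rewrite preimage_bigcup; exact: bigcup_measurable.
- rewrite -bigcup_seq => A [/= i _ [B mB <-]].
  by have := mf i measurableT _ mB; rewrite !setTI.
Qed.

Definition rV_cons (R : realType) (n : nat)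
    (z : measurableTypeR R * 'rV[R]_n) : 'rV[R]_n.+1 :=
  \row_i oapp (z.2 ord0) z.1 (unlift ord0 i).

Definition rV_uncons (R : realType) (n : nat)
    (v : 'rV[R]_n.+1) : measurableTypeR R * 'rV[R]_n :=
  (v ord0 ord0, \row_i v ord0 (lift ord0 i)).

Lemma rV_consK (R : realType) (n : nat) :
  cancel (@rV_cons R n) (@rV_uncons R n).
Proof.
move=> [x v]; rewrite /rV_uncons; congr pair.
  by rewrite mxE unlift_none.
by apply/rowP => i; rewrite !mxE liftK.
Qed.

Lemma measurable_rV_cons (R : realType) (n : nat) :
  measurable_fun [set: measurableTypeR R * 'rV[R]_n] (@rV_cons R n).
Proof.
apply: measurable_fun_coordP => i; case: (unliftP ord0 i) => [j ->|->].
- under eq_fun do rewrite mxE liftK.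
  exact: (measurableT_comp (@measurable_coord R n j) measurable_snd).
- under eq_fun do rewrite mxE unlift_none.
  exact: measurable_fst.
Qed.

Lemma measurable_rV_uncons (R : realType) (n : nat) :
  measurable_fun [set: 'rV[R]_n.+1] (@rV_uncons R n).
Proof.
apply: measurable_fun_pair; first exact: measurable_coord.
apply: measurable_fun_coordP => i.
under eq_fun do rewrite mxE.
exact: measurable_coord.
Qed.

Section rV_cons_measure.
Local Open Scope ereal_scope.
Context {R : realType} {n : nat}.
Variable mu : {sigma_finite_measure set 'rV[R]_n -> \bar R}.

Definition rV_cons_measure : set 'rV[R]_n.+1 -> \bar R :=
  pushforward (@lebesgue_measure R \x mu) (@rV_cons R n).

Let mcons := @measurable_rV_cons R n.

Let rV_cons_measure0 : rV_cons_measure set0 = 0.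
Proof. exact: measure0. Qed.

Let rV_cons_measure_ge0 A : 0 <= rV_cons_measure A.
Proof. exact: measure_ge0. Qed.

Let rV_cons_measure_sigma_additive : semi_sigma_additive rV_cons_measure.
Proof. exact: measure_semi_sigma_additive. Qed.

HB.instance Definition _ := isMeasure.Build _ _ _ rV_cons_measure
  rV_cons_measure0 rV_cons_measure_ge0 rV_cons_measure_sigma_additive.

Let rV_cons_measure_sigma_finite : sigma_finite setT rV_cons_measure.
Proof.
have /sigma_finiteP[F [TF ndF Foo]] := sigma_finiteT (@lebesgue_measure R).
have /sigma_finiteP[G [TG ndG Goo]] := sigma_finiteT mu.
exists (fun k => @rV_uncons R n @^-1` (F k `*` G k)).
  apply/esym; rewrite -subTset => v _.
  have : [set: measurableTypeR R] (rV_uncons v).1 by [].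
  have : [set: 'rV[R]_n] (rV_uncons v).2 by [].
  rewrite TF TG => -[k _ Gk] [l _ Fl]; exists (maxn l k) => //; split.
    by move: Fl; exact/subsetPset/ndF/leq_maxl.
  by move: Gk; exact/subsetPset/ndG/leq_maxr.
move=> k; have [mF Fk] := Foo k; have [mG Gk] := Goo k; split.
  rewrite -[X in measurable X]setTI.
  by apply: measurable_rV_uncons => //; exact: measurableX.
rewrite /rV_cons_measure /pushforward -comp_preimage.
rewrite (_ : _ \o _ = id); last by apply/funext => z /=; rewrite rV_consK.
by rewrite preimage_id product_measure1E// lte_mul_pinfty// ge0_fin_numE.
Qed.

HB.instance Definition _ := Measure_isSigmaFinite.Build _ _ _ rV_cons_measure
  rV_cons_measure_sigma_finite.

End rV_cons_measure.

Section dirac_sigma_finite.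
Context d (T : measurableType d) (R : realType) (a : T).

Let dirac_sigma_finite : sigma_finite setT (@dirac d T a R).
Proof.
apply: fin_num_fun_sigma_finite; first by rewrite diracE ltry.
by move=> A mA; rewrite diracE.
Qed.

Definition point_mass : set T -> \bar R := @dirac d T a R.

HB.instance Definition _ := Measure.on point_mass.
HB.instance Definition _ := Measure_isSigmaFinite.Build _ _ _ point_mass
  dirac_sigma_finite.

End dirac_sigma_finite.

(* n-dimensional Lebesgue measure, as an iterated product; R^0 is a point *)
Fixpoint lebn (R : realType) (n : nat) :
    {sigma_finite_measure set 'rV[R]_n -> \bar R} :=
  match n with
  | 0 => point_mass R (0 : 'rV[R]_0)
  | m.+1 => rV_cons_measure (lebn R m)
  end.

Lemma lebn_box (R : realType) (n : nat) (B : 'I_n -> set (measurableTypeR R)) :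
  (forall i, measurable (B i)) ->
  lebn R n [set x | forall i, B i (x ord0 i)] =
  (\prod_(i < n) lebesgue_measure (B i))%E.
Proof.
elim: n B => [|n IHn] B mB.
  rewrite big_ord0 /= /point_mass diracE mem_set// => -[] //.
rewrite big_ord_recl -IHn// -product_measure1E//; last first.
  rewrite [X in measurable X](_ : _ = \big[setI/setT]_(i < n)
      (fun x : 'rV[R]_n => x ord0 i : measurableTypeR R) @^-1` B (lift ord0 i)).
    apply: bigsetI_measurable => i _; rewrite -[X in measurable X]setTI.
    exact: measurable_coord.
  rewrite -bigcap_seq; apply/seteqP; split => x /= Bx i; first by move=> _; apply: Bx.
  by apply: Bx; rewrite /= mem_index_enum.
rewrite /= /rV_cons_measure /pushforward; congr (_ _).
apply/seteqP; split => [[x v]|[x v] [/= Bx Bv]] /= => [xv|i].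
  split => [|i]; first by have := xv ord0; rewrite mxE unlift_none.
  by have := xv (lift ord0 i); rewrite mxE liftK.
by rewrite mxE; case: unliftP => [j ->|->].
Qed.

Section euclidean_space.
Context {R : realType} {n : nat}.
Implicit Types (x a : 'rV[R]_n) (f : 'rV[R]_n -> R) (Omega : set 'rV[R]_n).

(* the library's norm on 'rV[R]_n is the sup norm *)
Definition enorm x : R := Num.sqrt (\sum_(i < n) x ord0 i ^+ 2).

Definition eball a (r : R) : set 'rV[R]_n := [set x | enorm (x - a) < r].

Definition iter_partial (l : seq 'I_n) f : 'rV[R]_n -> R :=
  foldr (fun i g x => 'D_(delta_mx ord0 i) g x) f l.

Definition smooth f : Prop := forall l : seq 'I_n,
  continuous (iter_partial l f) /\
  forall (i : 'I_n) x, derivable (iter_partial l f) x (delta_mx ord0 i).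

End euclidean_space.

(* Near each boundary point, up to the choice of the axis i and of its
   orientation b, Omega is the epigraph of a smooth function of the other
   n - 1 coordinates. *)
Definition smooth_boundary (R : realType) (n : nat) (Omega : set 'rV[R]_n) :=
  forall x0, (closure Omega `\` interior Omega) x0 ->
  exists (r : R) (i : 'I_n) (b : bool) (gamma : 'rV[R]_n.-1 -> R),
  [/\ 0 < r, smooth gamma &
      Omega `&` eball x0 r =
      [set x : 'rV[R]_n | 0 < (-1) ^+ b * (x ord0 i - gamma (col' i x))]
        `&` eball x0 r].

Definition smooth_bounded_domain (R : realType) (n : nat)
    (Omega : set 'rV[R]_n) : Prop :=
  [/\ Omega !=set0, open Omega, connected Omega, bounded_set Omega &
      smooth_boundary Omega].

Section fractional.
Local Open Scope ereal_scope.
Context {R : realType} {n : nat}.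
Implicit Types (s : R) (p u phi : 'rV[R]_n -> R) (Omega : set 'rV[R]_n).

Definition critical_exponent s : R := (2 * n%:R / (n%:R - 2 * s))%R.

(* on the diagonal, division by zero yields 0 *)
Definition gagliardo s u (x y : 'rV[R]_n) : R :=
  (`|u x - u y| ^+ 2 / enorm (x - y) `^ (n%:R + 2 * s))%R.

Definition Hs s u : Prop :=
  u \in Lfun (lebn R n) 2%:E /\
  \int[lebn R n \x lebn R n]_z (gagliardo s u z.1 z.2)%:E < +oo.

Definition Hs0 s Omega u : Prop :=
  Hs s u /\ \forall x \ae lebn R n, ~ Omega x -> u x = 0%R.

Definition energy s p u : \bar R :=
  \int[lebn R n]_x ((p x)%:E * \int[lebn R n]_y (gagliardo s u x y)%:E).

Definition admissible s Omega u : Prop :=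
  Hs0 s Omega u /\ 'N[lebn R n]_((critical_exponent s)%:E)[EFin \o u] = 1.

(* the infimum S_{s,0}(p), in the extended reals *)
Definition S_s0 s Omega p : \bar R :=
  ereal_inf [set energy s p u | u in admissible s Omega].

Definition minimizer s Omega p u : Prop :=
  admissible s Omega u /\ energy s p u = S_s0 s Omega p.

Definition weak_solution s Omega p u : Prop :=
  Hs0 s Omega u /\
  forall phi, Hs0 s Omega phi ->
    \int[lebn R n \x lebn R n]_z
       (p z.1 * ((u z.1 - u z.2) * (phi z.1 - phi z.2)
                 / enorm (z.1 - z.2) `^ (n%:R + 2 * s)))%:E =
    \int[lebn R n]_(x in Omega)
       (`|u x| `^ (critical_exponent s - 2) * u x * phi x)%:E.

(* Minimizers are normalized in L^{q_s}, which turns the right-hand side of the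
   Euler-Lagrange equation into a multiple of |u|^{q_s - 2} u; hence the factor
   c rescaling the solution to a minimizer. *)
Definition minimizing_solution s Omega p u : Prop :=
  weak_solution s Omega p u /\
  exists c : R, (0 < c)%R /\ minimizer s Omega p (fun x => (c * u x)%R).

End fractional.

(* Main.v *)
Require Import Defs.
From mathcomp Require Import all_boot all_order all_algebra.
From mathcomp Require Import all_classical all_reals all_analysis.
From mathcomp Require Import measurable_realfun ring lra.

Import Order.TTheory GRing.Theory Num.Theory.
Import numFieldNormedType.Exports.

Local Open Scope classical_set_scope.
Local Open Scope ring_scope.

(** Write [mu] for Lebesgue measure on R^n, [q] for the critical exponent and
    [E(u)] for the unweighted energy of [u], so that [S(1)] is the infimum of
    [E] over the admissible functions.

    Since [p >= p0], every admissible [u] satisfies [p0 * E(u) <= energy p u],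
    whence [p0 * S(1) <= S(p)].

    For the converse, let [u] be admissible for [Omega]; after replacing it by
    [|u|] and changing it on a null set, it vanishes off the bounded set
    [Omega] ([admissible_regular]).  At the critical exponent the constraint
    and the energy are both invariant under
    [u |-> e^(-(n-2s)/2) u((x - a)/e)], and for small [e] the rescaled function
    lives in a tiny ball around the minimum point [a], inside [Omega]
    ([rescale_admissible]).  Its weighted energy is [p0 * E(u)] plus the error
    [\int (p(a + e X) - p0) G(X) dX], where
    [G(X) = \int |u(X) - u(Y)|^2 / |X - Y|^(n+2s) dY].  Near [a] the growth
    bound makes [p - p0] small.  Far away nonlocality leaves a tail of [G], but
    there [u(X) = 0] and [G(X)] is at most a multiple of [|X|^-(n+2s)]; against
    the integrable function [p - p0] this tail costs
    [(e/d)^(n+2s) e^-n = O(e^(2s))].  The error thus tends to 0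
    ([weighted_energy_small]), and [S(p) <= p0 * E(u)] for every admissible
    [u] ([S_s0_le_transplant]).

    As for attainment, a minimizer [u] of the weighted problem satisfies
    [p0 * E(u) <= S(p) = p0 * S(1)], so it would minimize [E] as well.  But no
    admissible function minimizes [E] ([energy1_not_minimal]): let [v >= 0] be
    its regular version, and let [g] be a translate of [v] with disjoint
    support.  The cross term in [E(v + t g)] is negative, because for
    [v(x) > 0] and [g(y) > 0] the product of the increments
    [(v(x) - v(y)) (g(x) - g(y))] is [- v(x) g(y) < 0].  Hence
    [E(v + t g) = (1 + t^2) E(v) - 2 t K] with [K > 0], which is less than
    [E(v)] for small [t > 0], whereas the L^q norm has increased
    ([two_bumps]).  Rescaling [v + t g] into [Omega] and normalizing it gives
    an admissible function of strictly smaller energy. *)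

(** * Affine changes of variables *)

Section affine_change_of_variables.
Context {R : realType}.
Local Open Scope ereal_scope.

(** Both sides are integrals against measures, and Lebesgue measure is
    characterized by its values on half-open intervals. *)
Lemma ge0_lebesgue_affine (c e : R) (f : R -> \bar R) :
  (0 < e)%R -> measurable_fun setT f -> (forall x, 0 <= f x) ->
  \int[lebesgue_measure]_x f x =
  e%:E * \int[lebesgue_measure]_x f (c + e * x)%R.
Proof.
move=> e0 mf f0.
pose phi : measurableTypeR R -> measurableTypeR R := fun t => (c + e * t)%R.
have mphi : measurable_fun setT phi.
  by apply: measurable_funD => //; exact: measurable_funM.
pose e' : {nonneg R} := NngNum (ltW e0).
have := @ge0_integral_pushforward _ _ _ _ R phi mphi lebesgue_measure setT f
  measurableT mf (fun x _ => f0 x).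
rewrite preimage_setT /comp => <-.
have <- := @ge0_integral_mscale _ _ R (pushforward lebesgue_measure phi) setT
  measurableT e' f mf (fun x _ => f0 x).
apply: eq_measure_integral => A mA _.
apply: (@lebesgue_measure_unique R
  (mscale e' (pushforward lebesgue_measure phi))) => // _ [[a b]] _ <-.
rewrite /= /mscale/= /pushforward.
rewrite (_ : phi @^-1` _ =
    `](e^-1 * (a - c))%R, (e^-1 * (b - c))%R]%classic); last first.
  apply/seteqP; split => x; rewrite /phi /= !in_itv /= ltr_pdivrMl//
    ler_pdivlMl// ltrBlDl lerBrDl//.
rewrite !lebesgue_measure_itv/= !lte_fin ltr_pM2l ?invr_gt0// ltrD2r.
case: ifPn => _; last by rewrite mule0.
by rewrite -EFinD -EFinM -mulrBr mulrA mulfV ?gt_eqF// mul1r opprB addrA subrK.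
Qed.

Lemma measurable_affine n (a : 'rV[R]_n) (e : R) :
  measurable_fun setT (fun x : 'rV[R]_n => a + e *: x)%R.
Proof.
apply: measurable_fun_coordP => i.
under eq_fun do rewrite !mxE.
apply: measurable_funD => //; apply: measurable_funM => //.
exact: measurable_coord.
Qed.

Lemma ge0_integral_lebnS n (f : 'rV[R]_n.+1 -> \bar R) :
  measurable_fun setT f -> (forall x, 0 <= f x) ->
  \int[lebn R n.+1]_x f x =
  \int[lebesgue_measure]_t \int[lebn R n]_v f (rV_cons (t, v)).
Proof.
move=> mf f0.
have := @ge0_integral_pushforward _ _ _ _ R (@rV_cons R n)
  (@measurable_rV_cons R n) (lebesgue_measure \x lebn R n) setT f
  measurableT mf (fun x _ => f0 x).
rewrite preimage_setT /= /rV_cons_measure => ->.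
rewrite fubini_tonelli1 //.
by apply: measurableT_comp => //; exact: measurable_rV_cons.
Qed.

(** Induction on the dimension: peel off the first coordinate, and use the
    one-dimensional formula for it. *)
Lemma ge0_lebn_affine n (a : 'rV[R]_n) (e : R) (f : 'rV[R]_n -> \bar R) :
  (0 < e)%R -> measurable_fun setT f -> (forall x, 0 <= f x) ->
  \int[lebn R n]_x f x = (e ^+ n)%:E * \int[lebn R n]_x f (a + e *: x)%R.
Proof.
move=> e0; elim: n a f => [|n IHn] a f mf f0.
  rewrite expr0 mul1e; apply: eq_integral => x _; congr f.
  by apply/rowP => -[].
rewrite !ge0_integral_lebnS//; last first.
  by apply: measurableT_comp => //; exact: measurable_affine.
have mcons t : measurable_fun setT (fun v : 'rV[R]_n => f (rV_cons (t, v))).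
  apply: measurableT_comp => //.
  apply: (measurableT_comp (@measurable_rV_cons R n)).
  exact: measurable_fun_pair.
pose a' : 'rV[R]_n := (rV_uncons a).2.
under eq_integral => t _ do rewrite (IHn a')//.
have mpair : measurable_fun setT
    (fun z : measurableTypeR R * 'rV[R]_n => f (rV_cons (z.1, a' + e *: z.2)%R)).
  apply: measurableT_comp => //.
  apply: (measurableT_comp (@measurable_rV_cons R n)).
  apply: measurable_fun_pair; first exact: measurable_fst.
  exact: (measurableT_comp (measurable_affine n a' e) measurable_snd).
have mF := @measurable_fun_fubini_tonelli_F _ _ _ _ R (lebn R n) _ mpair
  (fun _ => f0 _).
rewrite ge0_integralZl//; last 2 first.
- by move=> t _; exact: integral_ge0.
- by rewrite lee_fin exprn_ge0// ltW.
rewrite [X in _ * X = _](ge0_lebesgue_affine (a ord0 ord0) e)//; last first.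
  by move=> t; exact: integral_ge0.
rewrite exprSr EFinM muleA; congr (_ * _).
apply: eq_integral => t _; apply: eq_integral => v _; congr f.
apply/rowP => i; rewrite !mxE; case: unliftP => [j ->|->] //=.
by rewrite !mxE.
Qed.

End affine_change_of_variables.

(** * The Euclidean norm against the sup norm *)

Section euclidean_norm.
Context {R : realType}.
Variable n : nat.
Implicit Types x : 'rV[R]_n.

Lemma enorm_ge0 x : 0 <= enorm x.
Proof. exact: sqrtr_ge0. Qed.

Lemma enormZ (e : R) x : 0 <= e -> enorm (e *: x) = e * enorm x.
Proof.
move=> e0; rewrite /enorm.
under eq_bigr do rewrite mxE exprMn.
by rewrite -mulr_sumr sqrtrM ?sqr_ge0// sqrtr_sqr ger0_norm.
Qed.

Lemma normr_coord x i : `|x ord0 i| <= `|x|.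
Proof.
rewrite [leRHS]/Num.norm/= mx_normrE.
exact: (le_bigmax _ (fun j : 'I_1 * 'I_n => `|x j.1 j.2|) (ord0, i)).
Qed.

Lemma normr_le_enorm x : `|x| <= enorm x.
Proof.
have [->|xn0] := eqVneq x 0; first by rewrite normr0 enorm_ge0.
have : mx_norm x != 0 by apply: contra_neq xn0 => /mx_norm_eq0.
move=> /mx_norm_neq0[[i j]] /= xij.
rewrite [leLHS](_ : _ = mx_norm x)// xij (ord1 i) -sqrtr_sqr ler_wsqrtr//.
by rewrite (bigD1 j)//= lerDl sumr_ge0// => k _; exact: sqr_ge0.
Qed.

(** The constant [n] is not sharp: only the comparability of the two norms
    matters in the sequel. *)
Lemma enorm_le_normr x : enorm x <= n%:R * `|x|.
Proof.
rewrite /enorm -[leRHS]ger0_norm ?mulr_ge0// -sqrtr_sqr ler_wsqrtr//.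
apply: (@le_trans _ _ (\sum_(i < n) `|x| ^+ 2)).
  apply: ler_sum => i _; rewrite -real_normK ?num_real//.
  by rewrite lerXn2r ?nnegrE// normr_coord.
rewrite sumr_const card_ord exprMn -[leLHS]mulr_natl ler_wpM2r ?sqr_ge0//.
rewrite -natrX ler_nat; case: (n) => // m.
by rewrite leq_pmulr.
Qed.

Lemma enorm_eq0 x : (enorm x == 0) = (x == 0).
Proof.
apply/idP/eqP => [|->]; last first.
  by rewrite /enorm big1 ?sqrtr0// => i _; rewrite mxE expr0n.
move=> /eqP x0; apply/eqP; rewrite -normr_le0 -x0; exact: normr_le_enorm.
Qed.

Lemma enorm_gt0 x : (0 < enorm x) = (x != 0).
Proof. by rewrite lt_neqAle eq_sym enorm_eq0 enorm_ge0 andbT. Qed.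

End euclidean_norm.

(** * The Gagliardo energy *)

Section seminorm.
Context {R : realType}.
Variables (n : nat) (s : R).
Local Open Scope ereal_scope.
Local Notation mu := (lebn R n).
Implicit Types (u v p : 'rV[R]_n -> R) (x y : 'rV[R]_n).

Lemma measurable_fun_powR d (T : measurableType d) (f : T -> R) (r : R) :
  measurable_fun [set: T] f -> measurable_fun [set: T] (fun t => f t `^ r)%R.
Proof. exact: (@measurableT_comp _ _ _ _ _ _ (@powR R ^~ r)). Qed.

Lemma measurable_enormB_powR (r : R) :
  measurable_fun setT (fun z : 'rV[R]_n * 'rV[R]_n => enorm (z.1 - z.2)%R `^ r)%R.
Proof.
apply: measurable_fun_powR.
under eq_fun => z do
  rewrite /enorm -powR12_sqrt ?(sumr_ge0 _ (fun i _ => sqr_ge0 _))//.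
apply: measurable_fun_powR.
apply: measurable_sum => i; apply: measurable_funX.
under eq_fun => z do rewrite !mxE.
apply: measurable_funB.
- apply: (@measurableT_comp _ _ _ _ _ _ (fun x : 'rV[R]_n => x ord0 i) _ fst).
    exact: measurable_coord.
  exact: measurable_fst.
- apply: (@measurableT_comp _ _ _ _ _ _ (fun x : 'rV[R]_n => x ord0 i) _ snd).
    exact: measurable_coord.
  exact: measurable_snd.
Qed.

Lemma gagliardo_ge0 u x y : (0 <= gagliardo s u x y)%R.
Proof. by rewrite divr_ge0// ?powR_ge0. Qed.

Lemma measurable_gagliardo u : measurable_fun [set: 'rV[R]_n] u ->
  measurable_fun setT
    (fun z : 'rV[R]_n * 'rV[R]_n => (gagliardo s u z.1 z.2)%:E).
Proof.
move=> mu_; apply/measurable_EFinP; rewrite /gagliardo.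
under eq_fun => z do rewrite -powRN.
apply: measurable_funM; last exact: measurable_enormB_powR.
apply: measurable_funX; apply: measurableT_comp => //.
apply: measurable_funB.
- exact: (measurableT_comp mu_ measurable_fst).
- exact: (measurableT_comp mu_ measurable_snd).
Qed.

Lemma measurable_gagliardo2 u x : measurable_fun [set: 'rV[R]_n] u ->
  measurable_fun [set: 'rV[R]_n] (fun y => (gagliardo s u x y)%:E).
Proof. by move=> /measurable_gagliardo /measurable_fun_pair2; exact. Qed.

Lemma measurable_gagliardo_int u : measurable_fun [set: 'rV[R]_n] u ->
  measurable_fun [set: 'rV[R]_n] (fun x => \int[mu]_y (gagliardo s u x y)%:E).
Proof.
move=> /measurable_gagliardo mg.
have := @measurable_fun_fubini_tonelli_F _ _ _ _ R mu _ mg.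
by apply=> z; rewrite lee_fin gagliardo_ge0.
Qed.

Lemma gagliardo_int_ge0 u x : 0 <= \int[mu]_y (gagliardo s u x y)%:E.
Proof. by apply: integral_ge0 => y _; rewrite lee_fin gagliardo_ge0. Qed.

(** Tonelli: the condition in [Hs], an integral over the product space, is the
    finiteness of the unweighted energy. *)
Lemma energy1E u : measurable_fun [set: 'rV[R]_n] u ->
  energy s (fun=> 1%R) u = \int[mu \x mu]_z (gagliardo s u z.1 z.2)%:E.
Proof.
move=> mu_; rewrite /energy fubini_tonelli1; last 2 first.
- exact: measurable_gagliardo.
- by move=> z; rewrite lee_fin gagliardo_ge0.
by apply: eq_integral => x _; rewrite mul1e.
Qed.

Lemma energy_ge0 p u : (forall x, (0 <= p x)%R) -> 0 <= energy s p u.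
Proof.
move=> p0; apply: integral_ge0 => x _.
by rewrite mule_ge0 ?lee_fin ?gagliardo_int_ge0.
Qed.

Lemma measurable_energy_density p u : measurable_fun [set: 'rV[R]_n] p ->
  measurable_fun [set: 'rV[R]_n] u ->
  measurable_fun [set: 'rV[R]_n]
    (fun x => (p x)%:E * \int[mu]_y (gagliardo s u x y)%:E).
Proof.
move=> mp mu_; apply: emeasurable_funM; first exact/measurable_EFinP.
exact: measurable_gagliardo_int.
Qed.

End seminorm.

(** * Invariance under rescaling *)

Section rescaling.
Context {R : realType}.
Variables (n : nat) (s : R).
Local Open Scope ereal_scope.
Local Notation mu := (lebn R n).
Local Notation q := (critical_exponent (n := n) s).
Implicit Types (u v w p : 'rV[R]_n -> R) (x y a : 'rV[R]_n).

(** The bump [c * v] shrunk by the factor [e] and moved from the origin to [a]. *)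
Definition rescale (a : 'rV[R]_n) (e c : R) (v : 'rV[R]_n -> R) : 'rV[R]_n -> R :=
  fun x => (c * v (e^-1 *: (x - a)))%R.

Lemma rescale_affine a e c v x : (0 < e)%R ->
  rescale a e c v (a + e *: x)%R = (c * v x)%R.
Proof.
by move=> e0; rewrite /rescale addrAC subrr add0r scalerA mulVf ?gt_eqF// scale1r.
Qed.

Lemma measurable_rescale a e c v : measurable_fun [set: 'rV[R]_n] v ->
  measurable_fun [set: 'rV[R]_n] (rescale a e c v).
Proof.
move=> mv; apply: measurable_funM => //; apply: measurableT_comp => //.
rewrite (_ : (fun x => _) = (fun x => - (e^-1 *: a) + e^-1 *: x)%R).
  exact: measurable_affine.
by apply/funext => x; rewrite scalerBr addrC.
Qed.

Lemma measurable_normr_powR u (r : R) : measurable_fun [set: 'rV[R]_n] u ->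
  measurable_fun [set: 'rV[R]_n] (fun x => (`|u x| `^ r)%:E).
Proof.
move=> mu_; apply/measurable_EFinP/measurable_fun_powR.
exact: measurableT_comp.
Qed.

Lemma integral_powR_rescale a e c v r : (0 < e)%R ->
  measurable_fun [set: 'rV[R]_n] v ->
  \int[mu]_x (`|rescale a e c v x| `^ r)%:E =
  (`|c| `^ r * e ^+ n)%:E * \int[mu]_x (`|v x| `^ r)%:E.
Proof.
move=> e0 mv.
have mw := measurable_normr_powR _ r (measurable_rescale a e c v mv).
rewrite (ge0_lebn_affine n a e _ e0 mw); last first.
  by move=> x; rewrite lee_fin powR_ge0.
under eq_integral => x _ do
  rewrite rescale_affine// normrM powRM ?normr_ge0// EFinM.
rewrite ge0_integralZl//.
- by rewrite muleA -EFinM mulrC.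
- exact: measurable_normr_powR.
Qed.

Lemma gagliardo_rescale a e c v x y : (0 < e)%R ->
  gagliardo s (rescale a e c v) (a + e *: x)%R (a + e *: y)%R =
  (c ^+ 2 * (e `^ (n%:R + 2 * s))^-1 * gagliardo s v x y)%R.
Proof.
move=> e0; rewrite /gagliardo !rescale_affine//.
rewrite [(a + _ - _)%R](_ : _ = e *: (x - y))%R; last first.
  by rewrite opprD addrACA subrr add0r -scalerBr.
rewrite enormZ 1?ltW// powRM ?enorm_ge0// 1?ltW// -mulrBr normrM exprMn.
by rewrite real_normK ?num_real// invfM; ring.
Qed.

(** The double integral contributes [e^(2n)] and the kernel [e^-(n+2s)]. *)
Lemma energy_rescale a e c p v : (0 < e)%R ->
  measurable_fun [set: 'rV[R]_n] p -> (forall x, (0 <= p x)%R) ->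
  measurable_fun [set: 'rV[R]_n] v ->
  energy s p (rescale a e c v) =
  (c ^+ 2 * e `^ (n%:R - 2 * s))%:E *
    \int[mu]_x ((p (a + e *: x)%R)%:E * \int[mu]_y (gagliardo s v x y)%:E).
Proof.
move=> e0 mp p0 mv; have mw := measurable_rescale a e c v mv.
have me : measurable_fun [set: 'rV[R]_n] (fun x => p (a + e *: x)%R).
  by apply: measurableT_comp => //; exact: measurable_affine.
rewrite [LHS](ge0_lebn_affine n a e _ e0
  (measurable_energy_density n s _ _ mp mw)).
2: by move=> x; rewrite mule_ge0 ?lee_fin ?gagliardo_int_ge0.
have E x : \int[mu]_y (gagliardo s (rescale a e c v) (a + e *: x)%R y)%:E =
    (e ^+ n * (c ^+ 2 * (e `^ (n%:R + 2 * s))^-1))%:E *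
    \int[mu]_y (gagliardo s v x y)%:E.
  rewrite [LHS](ge0_lebn_affine n a e _ e0 (measurable_gagliardo2 n s _ _ mw)).
  2: by move=> y; rewrite lee_fin gagliardo_ge0.
  pose k : R := (c ^+ 2 * (e `^ (n%:R + 2 * s))^-1)%R.
  have Ek y : (gagliardo s (rescale a e c v) (a + e *: x)%R (a + e *: y)%R)%:E =
      k%:E * (gagliardo s v x y)%:E.
    by rewrite gagliardo_rescale.
  rewrite [in LHS](eq_integral (fun y => k%:E * (gagliardo s v x y)%:E));
    last by move=> y _; exact: Ek.
  rewrite ge0_integralZl//.
  - by rewrite muleA -EFinM.
  - exact: measurable_gagliardo2.
  - by move=> y _; rewrite lee_fin gagliardo_ge0.
  - by rewrite lee_fin mulr_ge0 ?sqr_ge0// invr_ge0 powR_ge0.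
(* Powers of [e]: one [e^n] from each variable, [e^-(n+2s)] from the kernel. *)
pose k : R := (e ^+ n * (c ^+ 2 * (e `^ (n%:R + 2 * s))^-1))%R.
rewrite [in LHS](eq_integral (fun x => k%:E *
  ((p (a + e *: x)%R)%:E * \int[mu]_y (gagliardo s v x y)%:E)))%E; last first.
  by move=> x _; rewrite [X in _ * X = _]E; exact: muleCA.
rewrite [in LHS]ge0_integralZl//.
- rewrite muleA -EFinM; congr (_%:E * _).
  rewrite /k -[(e ^+ n)%R]powR_mulrn ?ltW//.
  have -> : (e `^ (n%:R - 2 * s) = e `^ n%:R * e `^ n%:R / e `^ (n%:R + 2 * s))%R.
    rewrite (_ : (n%:R - 2 * s = n%:R + n%:R - (n%:R + 2 * s))%R); last by ring.
    by rewrite powRB ?(gt_eqF e0) ?implybT// powRD ?(gt_eqF e0) ?implybT.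
  by ring.
- exact: measurable_energy_density.
- by move=> x _; rewrite mule_ge0 ?lee_fin ?gagliardo_int_ge0.
- rewrite lee_fin; apply: mulr_ge0; first by rewrite exprn_ge0// ltW.
  by apply: mulr_ge0; rewrite ?sqr_ge0// invr_ge0 powR_ge0.
Qed.

Lemma Lnorm_EFin (r : R) u :
  'N[mu]_(r%:E)[EFin \o u] = (\int[mu]_x (`|u x| `^ r)%:E) `^ r^-1.
Proof. by rewrite unlock. Qed.

Lemma admissible_of_finite Omega u : (0 < q)%R ->
  measurable_fun [set: 'rV[R]_n] u -> (forall x, ~ Omega x -> u x = 0%R) ->
  \int[mu]_x (`|u x| `^ 2)%:E < +oo -> energy s (fun=> 1%R) u < +oo ->
  \int[mu]_x (`|u x| `^ q)%:E = 1 -> admissible s Omega u.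
Proof.
move=> q0 mu_ u0 u2 uE uq; split; last by rewrite Lnorm_EFin uq poweR1r.
split; last exact: aeW.
split; last by rewrite -energy1E.
rewrite inE; apply/andP; split; rewrite inE/=; first exact: mu_.
by rewrite /finite_norm Lnorm_EFin poweR_lty.
Qed.

(** The amplitude is chosen to normalize the L^q norm.  Because
    [2 / q = (n - 2s) / n], the powers of [e] in the energy then cancel, and
    only the argument of the weight still depends on the scale. *)
Lemma rescale_admissible a e p v (Q : R) Omega : (2 * s < n%:R)%R -> (0 < n)%N ->
  (0 < e)%R ->
  measurable_fun [set: 'rV[R]_n] p -> (forall x, (0 <= p x)%R) ->
  measurable_fun [set: 'rV[R]_n] v ->
  \int[mu]_x (`|v x| `^ 2)%:E < +oo -> energy s (fun=> 1%R) v < +oo ->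
  (0 < Q)%R -> \int[mu]_x (`|v x| `^ q)%:E = Q%:E ->
  (forall x, v x != 0%R -> Omega (a + e *: x)%R) ->
  exists w, admissible s Omega w /\
    energy s p w = (Q `^ (- 2 / q))%:E *
    \int[mu]_x ((p (a + e *: x)%R)%:E * \int[mu]_y (gagliardo s v x y)%:E).
Proof.
move=> sn n0 e0 mp p0 mv v2 vE Q0 vQ vO.
have ns0 : (0 < n%:R - 2 * s)%R by rewrite subr_gt0.
have q0 : (0 < q)%R by rewrite divr_gt0// mulr_gt0// ltr0n.
have qn0 : q != 0%R by rewrite gt_eqF.
pose c : R := ((e ^+ n * Q) `^ (- q^-1))%R.
have eQ0 : (0 < e ^+ n * Q)%R by rewrite mulr_gt0// exprn_gt0.
have c0 : (0 <= c)%R by exact: powR_ge0.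
exists (rescale a e c v); split.
  apply: admissible_of_finite; first exact: q0.
  - exact: measurable_rescale.
  - move=> x Ox; apply: contra_notP Ox => /eqP.
    rewrite /rescale mulf_eq0 negb_or => /andP[_ /vO].
    by rewrite scalerA mulfV ?gt_eqF// scale1r addrC subrK.
  - rewrite integral_powR_rescale// lte_mul_pinfty// lee_fin.
    by rewrite mulr_ge0 ?powR_ge0// exprn_ge0// ltW.
  - rewrite energy_rescale// lte_mul_pinfty//.
    by rewrite lee_fin mulr_ge0 ?sqr_ge0 ?powR_ge0.
  - rewrite integral_powR_rescale// vQ -EFinM; congr EFin.
    rewrite ger0_norm// /c -powRrM mulNr mulVf// powRN powRr1 ?ltW//.
    by rewrite -mulrA mulVf// gt_eqF.
rewrite energy_rescale//; congr (_%:E * _).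
have -> : (c ^+ 2 = e `^ (n%:R * (- q^-1 * 2)) * Q `^ (- q^-1 * 2))%R.
  rewrite /c -powR_mulrn ?powR_ge0// -powRrM powRM ?exprn_ge0 ?ltW//.
  by rewrite -[(e ^+ n)%R]powR_mulrn 1?ltW// -powRrM.
rewrite mulrAC -powRD; last by rewrite (gt_eqF e0) implybT.
(* This is where criticality of [q] enters. *)
have -> : (n%:R * (- q^-1 * 2) + (n%:R - 2 * s) = 0)%R.
  rewrite /critical_exponent; field.
  by rewrite !gt_eqF// ltr0n.
by rewrite powRr0 mul1r; congr (_ `^ _)%R; ring.
Qed.

End rescaling.

(** * Regular representatives of admissible functions *)

Section regularization.
Context {R : realType}.
Variables (n : nat) (s : R).
Local Open Scope ereal_scope.
Local Notation mu := (lebn R n).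
Local Notation q := (critical_exponent (n := n) s).
Implicit Types (u v : 'rV[R]_n -> R).

Lemma admissible_data (Omega : set 'rV[R]_n) u : (0 < q)%R ->
  admissible s Omega u ->
  [/\ measurable_fun [set: 'rV[R]_n] u, \int[mu]_x (`|u x| `^ 2)%:E < +oo,
      \int[mu]_x (`|u x| `^ q)%:E = 1 & energy s (fun=> 1%R) u < +oo].
Proof.
move=> q0 [[[+ Eu] _] uq].
rewrite inE => /andP[]; rewrite !inE/= => mu_ u2; split => //.
- apply: (@lty_poweRy _ _ 2^-1); first by rewrite invr_neq0.
  by rewrite -Lnorm_EFin.
- have := @poweR_Lnorm _ _ _ mu (EFin \o u) q; rewrite uq poweR1r => <- //.
  by rewrite gt_eqF.
- by rewrite energy1E.
Qed.

(** The reverse triangle inequality, applied under both integrals. *)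
Lemma le_energy1_ae u v : measurable_fun [set: 'rV[R]_n] u ->
  measurable_fun [set: 'rV[R]_n] v -> {ae mu, forall x, v x = `|u x|%R} ->
  energy s (fun=> 1%R) v <= energy s (fun=> 1%R) u.
Proof.
move=> mu_ mv vu; rewrite /energy; apply: ae_ge0_le_integral => //.
- by move=> x _; rewrite mul1e gagliardo_int_ge0.
- exact: measurable_energy_density.
- by move=> x _; rewrite mul1e gagliardo_int_ge0.
- exact: measurable_energy_density.
apply: filterS (vu) => x vux _; rewrite !mul1e; apply: ae_ge0_le_integral => //.
- by move=> y _; rewrite lee_fin gagliardo_ge0.
- exact: measurable_gagliardo2.
- by move=> y _; rewrite lee_fin gagliardo_ge0.
- exact: measurable_gagliardo2.
apply: filterS vu => y vuy _; rewrite lee_fin /gagliardo vux vuy.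
rewrite ler_wpM2r ?invr_ge0 ?powR_ge0// lerXn2r ?nnegrE//.
exact: ler_dist_dist.
Qed.

(** The null set on which [u] may fail to vanish off [Omega] is contained in a
    measurable null set [N]; multiplying [|u|] by the indicator of the
    complement of [N], instead of that of [Omega], gives a measurable function. *)
Lemma admissible_regular (Omega : set 'rV[R]_n) u : (0 < q)%R ->
  admissible s Omega u ->
  exists v, [/\ measurable_fun [set: 'rV[R]_n] v /\ (forall x, (0 <= v x)%R),
    (forall x, v x != 0%R -> Omega x), \int[mu]_x (`|v x| `^ 2)%:E < +oo,
    \int[mu]_x (`|v x| `^ q)%:E = 1 &
    energy s (fun=> 1%R) v <= energy s (fun=> 1%R) u].
Proof.
move=> q0 au; have [mu_ u2 uq Eu] := admissible_data _ _ q0 au.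
have [[_ [N [mN N0 uN]]] _] := au.
pose v : 'rV[R]_n -> R := fun x => (`|u x| * \1_(~` N) x)%R.
have mv : measurable_fun [set: 'rV[R]_n] v.
  apply: measurable_funM; first exact: measurableT_comp.
  exact/measurable_indic/measurableC.
have vu : {ae mu, forall x, v x = `|u x|%R}.
  exists N; split => // x /= vx; apply: contrapT => Nx; apply: vx.
  by rewrite /v indicE mem_set// mulr1.
have int_vu r : \int[mu]_x (`|v x| `^ r)%:E = \int[mu]_x (`|u x| `^ r)%:E.
  apply: ge0_ae_eq_integral => //; try exact: measurable_normr_powR.
  by apply: filterS vu => x -> _; rewrite normr_id.
exists v; split.
- by split => // x; rewrite mulr_ge0.
- move=> x vx; apply: contrapT => Ox; move/negP: vx; apply.
  rewrite /v indicE; have [xN|xN] := boolP (x \in ~` N); last by rewrite mulr0.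
  rewrite mulf_eq0 normr_eq0; apply/orP; left; apply/eqP; apply: contrapT => ux.
  by move: xN; rewrite inE => xN; apply: xN; apply: uN => h; exact: (ux (h Ox)).
- by rewrite int_vu.
- by rewrite int_vu.
- exact: le_energy1_ae.
Qed.

End regularization.

(** * The tail of the energy density *)

Section concentration.
Context {R : realType}.
Variables (n : nat) (s : R).
Hypothesis s0 : 0 < s.
Local Open Scope ereal_scope.
Local Notation mu := (lebn R n).
Implicit Types (v h : 'rV[R]_n -> R) (x y a : 'rV[R]_n).

(** Off the support of [v] the integrand reduces to [|v y|^2] times the kernel,
    and a point of the support is at distance at least [rho / 2] from [x]. *)
Lemma gagliardo_int_far v (M rho : R) x : (0 < M)%R -> (2 * M <= rho)%R ->
  (rho <= `|x|)%R -> measurable_fun [set: 'rV[R]_n] v ->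
  (forall y, v y != 0%R -> (`|y| <= M)%R) ->
  \int[mu]_y (gagliardo s v x y)%:E <=
  ((rho / 2) `^ (- (n%:R + 2 * s)))%:E * \int[mu]_y (`|v y| `^ 2)%:E.
Proof.
move=> M0 Mr rx mv vM.
rewrite -ge0_integralZl//; last 2 first.
- exact: measurable_normr_powR.
- by rewrite lee_fin powR_ge0.
apply: ge0_le_integral => //.
- by move=> y _; rewrite lee_fin gagliardo_ge0.
- exact: measurable_gagliardo2.
- by apply: measurable_funeM; exact: measurable_normr_powR.
move=> y _; rewrite -EFinM lee_fin /gagliardo.
have vx : v x = 0%R by apply: contrapT => /eqP /vM xM; lra.
rewrite vx sub0r normrN mulrC powR_mulrn//.
have [->|vy] := eqVneq (v y) 0%R; first by rewrite normr0 expr0n/= !mulr0.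
apply: ler_wpM2r; first by rewrite exprn_ge0.
have rho0 : (0 < rho / 2)%R by lra.
have rxy : (rho / 2 <= enorm (x - y))%R.
  apply: le_trans (normr_le_enorm _ _); have := vM _ vy.
  by have := lerB_dist x y; lra.
rewrite powRN lef_pV2 ?posrE ?powR_gt0//; last exact: lt_le_trans rxy.
have ns0 : (0 <= n%:R + 2 * s)%R by rewrite addr_ge0 ?ler0n// mulr_ge0// ltW.
apply: ge0_ler_powR => //; rewrite nnegrE; first exact: ltW.
exact: enorm_ge0.
Qed.

(** Splitting at [`|x| = rho]: the weight is small inside, and the energy
    density is small outside.  The sum of the two bounds dominates the
    integrand everywhere. *)
Lemma weighted_energy_le a v h (e rho tau M : R) : (0 < e)%R ->
  (0 < M)%R -> (2 * M <= rho)%R -> (0 <= tau)%R ->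
  measurable_fun [set: 'rV[R]_n] v ->
  (forall y, v y != 0%R -> (`|y| <= M)%R) ->
  measurable_fun [set: 'rV[R]_n] h -> (forall x, (0 <= h x)%R) ->
  (forall x, (`|x| < rho)%R -> (h (a + e *: x) <= tau)%R) ->
  \int[mu]_x ((h (a + e *: x)%R)%:E * \int[mu]_y (gagliardo s v x y)%:E) <=
  tau%:E * energy s (fun=> 1%R) v +
  ((rho / 2) `^ (- (n%:R + 2 * s)))%:E * \int[mu]_y (`|v y| `^ 2)%:E *
    \int[mu]_x (h (a + e *: x)%R)%:E.
Proof.
move=> e0 M0 Mr t0 mv vM mh h0 ht.
set C := _ * \int[mu]_y (`|v y| `^ 2)%:E.
have C0 : 0 <= C.
  by rewrite mule_ge0 ?lee_fin ?powR_ge0// integral_ge0.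
have mhe : measurable_fun [set: 'rV[R]_n] (fun x => (h (a + e *: x)%R)%:E).
  apply/measurable_EFinP; apply: measurableT_comp => //.
  exact: measurable_affine.
have mG := measurable_gagliardo_int n s v mv.
have m1 : measurable_fun [set: 'rV[R]_n]
    (fun x => 1%:E * \int[mu]_y (gagliardo s v x y)%:E).
  by apply: measurable_energy_density.
rewrite /energy -ge0_integralZl//; last first.
  by move=> x _; rewrite mul1e gagliardo_int_ge0.
rewrite -[in leRHS]ge0_integralZl//; last first.
  by move=> x _; rewrite lee_fin.
rewrite -ge0_integralD//; last 4 first.
- by move=> x _; rewrite mul1e mule_ge0 ?lee_fin ?gagliardo_int_ge0.
- exact: measurable_funeM.
- by move=> x _; rewrite mule_ge0// lee_fin.
- exact: measurable_funeM.
apply: ge0_le_integral => //.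
- by move=> x _; rewrite mule_ge0 ?lee_fin ?gagliardo_int_ge0.
- exact: emeasurable_funM.
- by apply: emeasurable_funD; exact: measurable_funeM.
move=> x _; rewrite mul1e; have [xr|rx] := ltP `|x|%R rho.
  rewrite -[leLHS]adde0; apply: leeD; last by rewrite mule_ge0// lee_fin.
  by apply: lee_wpmul2r; rewrite ?gagliardo_int_ge0// lee_fin ht.
rewrite -[leLHS]add0e; apply: leeD.
  by rewrite mule_ge0 ?lee_fin ?gagliardo_int_ge0.
rewrite muleC; apply: lee_wpmul2r; first by rewrite lee_fin.
exact: (gagliardo_int_far _ M).
Qed.

End concentration.

(** * Transplanting a bump to the minimum point *)

Lemma ge0_lty_EFin (R : realType) (x : \bar R) :
  (0 <= x -> x < +oo -> exists2 r : R, (0 <= r)%R & x = r%:E)%E.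
Proof.
move=> x0 xoo; exists (fine x); first exact: fine_ge0.
by rewrite fineK// ge0_fin_numE.
Qed.

Section transplantation.
Context {R : realType}.
Variables (n : nat) (s : R).
Hypothesis s0 : 0 < s.
Local Open Scope ereal_scope.
Local Notation mu := (lebn R n).
Local Notation q := (critical_exponent (n := n) s).
Implicit Types (v h p : 'rV[R]_n -> R) (x y a : 'rV[R]_n).

Lemma enorm_affine_le a x (e : R) : (0 <= e)%R ->
  (enorm (a + e *: x - a) <= e * (n.+1%:R * `|x|))%R.
Proof.
move=> e0; rewrite addrC addrA addNr add0r enormZ// ler_wpM2l//.
apply: le_trans (enorm_le_normr _ x) _.
by rewrite ler_wpM2r// ler_nat.
Qed.

Lemma powR_small_mul (A r delta : R) : (0 <= A)%R -> (0 < r)%R -> (0 < delta)%R ->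
  exists2 e0 : R, (0 < e0)%R &
    forall e, (0 < e <= e0)%R -> (A * e `^ r <= delta)%R.
Proof.
move=> A0 r0 d0; have dA : (0 < delta / (A + 1))%R by rewrite divr_gt0//; lra.
exists ((delta / (A + 1)) `^ r^-1)%R; first exact: powR_gt0.
move=> e /andP[e0 ee].
have er : (e `^ r <= delta / (A + 1))%R.
  have -> : (delta / (A + 1) = ((delta / (A + 1)) `^ r^-1) `^ r)%R.
    by rewrite -powRrM mulVf ?gt_eqF// powRr1// ltW.
  apply: ge0_ler_powR; rewrite ?nnegrE//; first exact: ltW.
  - exact: ltW.
  - exact: powR_ge0.
apply: (@le_trans _ _ ((A + 1) * (delta / (A + 1)))%R).
  apply: ler_pM => //; first exact: powR_ge0.
  by lra.
by rewrite mulrCA divff ?mulr1// gt_eqF//; lra.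
Qed.

(** The radius [d] around [a] on which the growth bound is used is fixed before
    the scale [e]: it makes the inner part at most [delta / 2] for every [e].
    With [rho = d / e] the outer part is then a constant times [e^(2s)]. *)
Lemma weighted_energy_small a v h (M r0 kappa k e1 delta : R) :
  (0 < M)%R -> (0 < r0)%R -> (0 < kappa)%R -> (1 <= k)%R ->
  (0 < e1)%R -> (0 < delta)%R ->
  measurable_fun [set: 'rV[R]_n] v ->
  (forall y, v y != 0%R -> (`|y| <= M)%R) ->
  \int[mu]_x (`|v x| `^ 2)%:E < +oo -> energy s (fun=> 1%R) v < +oo ->
  measurable_fun [set: 'rV[R]_n] h -> (forall x, (0 <= h x)%R) ->
  \int[mu]_x (h x)%:E < +oo ->
  (forall x, eball a r0 x -> (h x <= kappa * enorm (x - a) `^ k)%R) ->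
  exists2 e : R, (0 < e <= e1)%R &
  \int[mu]_x ((h (a + e *: x)%R)%:E * \int[mu]_y (gagliardo s v x y)%:E)
    <= delta%:E.
Proof.
move=> M0 r00 kappa0 k1 e10 d0 mv vM v2 vE mh h0 hint hgrow.
have [E E0 EE] := ge0_lty_EFin _ _
  (energy_ge0 n s _ v (fun=> ler01)) vE.
have vL0 : 0 <= \int[mu]_x (`|v x| `^ 2)%:E by exact: integral_ge0.
have [L L0 LE] := ge0_lty_EFin _ _ vL0 v2.
have hE0 x : 0 <= (h x)%:E by rewrite lee_fin.
have hH0 : 0 <= \int[mu]_x (h x)%:E by exact: integral_ge0.
have [H H0 HE] := ge0_lty_EFin _ _ hH0 hint.
pose N : R := n.+1%:R.
have N0 : (0 < N)%R by rewrite ltr0n.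
(* [t] bounds the Euclidean distance to [a] on the inner region; as [t <= 1]
   and [1 <= k], the growth bound there is at most [kappa * t]. *)
pose t : R := (Num.min 1 (Num.min (r0 / 2) (delta / (2 * (kappa * (E + 1))))))%R.
have kE0 : (0 < kappa * (E + 1))%R by rewrite mulr_gt0//; lra.
have t0 : (0 < t)%R.
  by rewrite !lt_min ltr01/= divr_gt0//= divr_gt0// mulr_gt0.
have t1 : (t <= 1)%R by rewrite ge_min lexx.
have tr : (t < r0)%R.
  apply: (@le_lt_trans _ _ (r0 / 2)%R); last by lra.
  by rewrite /t !ge_min lexx orbT.
have tE : (kappa * t * E <= delta / 2)%R.
  apply: (@le_trans _ _ (kappa * (E + 1) * t)%R).
    have kt : (0 < kappa * t)%R by rewrite mulr_gt0.
    by rewrite mulrDr mulrDl mulr1 mulrAC lerDl ltW.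
  rewrite mulrC -ler_pdivlMr// /t.
  rewrite -mulrA -invfM.
  by rewrite !ge_min lexx !orbT.
pose d := (t / N)%R.
have dd0 : (0 < d)%R by rewrite divr_gt0.
pose A := ((d / 2) `^ (- (n%:R + 2 * s)) * L * H)%R.
have A0 : (0 <= A)%R by rewrite !mulr_ge0 ?powR_ge0.
have s20 : (0 < 2 * s)%R by rewrite mulr_gt0.
have d20 : (0 < delta / 2)%R by lra.
have [e2 e20 he2] := powR_small_mul _ _ _ A0 s20 d20.
pose e : R := (Num.min e1 (Num.min e2 (d / (2 * M))))%R.
have e0 : (0 < e)%R by rewrite !lt_min e10 e20/= divr_gt0// mulr_gt0.
exists e; first by rewrite e0/= ge_min lexx.
have ee2 : (0 < e <= e2)%R by rewrite e0/= /e !ge_min lexx orbT.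
have edM : (2 * M <= d / e)%R.
  rewrite ler_pdivlMr// mulrC -ler_pdivlMr ?mulr_gt0//.
  by rewrite /e !ge_min lexx !orbT.
have near_a x : (`|x| < d / e)%R -> (h (a + e *: x) <= kappa * t)%R.
  move=> xd; have xt : (enorm (a + e *: x - a) <= t)%R.
    apply: le_trans (enorm_affine_le _ _ _ (ltW e0)) _.
    rewrite mulrCA -/N mulrC -ler_pdivlMr// -/d mulrC -ler_pdivlMr//.
    exact: ltW.
  apply: le_trans (hgrow _ _) _; first exact: le_lt_trans tr.
  apply: ler_wpM2l; first exact: ltW.
  apply: (@le_trans _ _ (t `^ k)%R).
    apply: ge0_ler_powR; rewrite ?nnegrE ?enorm_ge0//; [lra|exact: ltW].
  by apply: ge1r_powR; rewrite ?t0.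
apply: le_trans (weighted_energy_le n s s0 a v h e (d / e) (kappa * t) M
  e0 M0 edM _ mv vM mh h0 near_a) _.
  by rewrite mulr_ge0// ltW.
(* The scaled weight has mass [e^-n H]; against the factor [e^(n+2s)] of the
   tail this leaves [e^(2s)]. *)
have KE : \int[mu]_x (h (a + e *: x)%R)%:E = ((e ^+ n)^-1 * H)%:E.
  have mhE : measurable_fun [set: 'rV[R]_n] (EFin \o h) by exact/measurable_EFinP.
  have HaE := ge0_lebn_affine n a e _ e0 mhE hE0.
  rewrite EFinM -HE HaE.
  rewrite muleA -EFinM mulVf ?mul1e// gt_eqF// exprn_gt0//.
rewrite EE LE KE -!EFinM -EFinD lee_fin.
have -> : (d / e / 2 = e^-1 * (d / 2))%R by ring.
have e0' : (0 <= e^-1)%R by rewrite invr_ge0 ltW.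
have d20' : (0 <= d / 2)%R by lra.
rewrite powRM// -{1}(powR_inv1 (ltW e0)) -powRrM mulN1r opprK.
rewrite powRD ?(gt_eqF e0) ?implybT// (powR_mulrn _ (ltW e0)).
have en : (e ^+ n != 0)%R by rewrite gt_eqF// exprn_gt0.
have -> : (e ^+ n * e `^ (2 * s) * (d / 2) `^ (- (n%:R + 2 * s)) * L *
   ((e ^+ n)^-1 * H) = A * e `^ (2 * s))%R by rewrite /A; field.
by rewrite [leRHS]splitr lerD// he2.
Qed.

(** The transplanted bumps are competitors in the weighted problem whose
    energies come arbitrarily close to [p a] times the energy of [v]. *)
Lemma S_s0_le_transplant Omega a p v (eta kappa k M : R) :
  (2 * s < n%:R)%R -> (0 < n)%N ->
  measurable_fun [set: 'rV[R]_n] p -> (0 < p a)%R -> (forall x, p a <= p x)%R ->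
  \int[mu]_x (p x - p a)%:E < +oo ->
  (0 < eta)%R -> eball a (4 * eta) `<=` Omega ->
  (0 < kappa)%R -> (1 <= k)%R ->
  (forall x, eball a (4 * eta) x -> p x <= p a + kappa * enorm (x - a) `^ k)%R ->
  (0 < M)%R -> measurable_fun [set: 'rV[R]_n] v ->
  (forall y, v y != 0%R -> (`|y| <= M)%R) ->
  \int[mu]_x (`|v x| `^ 2)%:E < +oo -> energy s (fun=> 1%R) v < +oo ->
  \int[mu]_x (`|v x| `^ q)%:E = 1 ->
  S_s0 s Omega p <= (p a)%:E * energy s (fun=> 1%R) v.
Proof.
move=> sn n0 mp pa0 pmin pint eta0 aO kappa0 k1 pgrow M0 mv vM v2 vE vq.
apply/lee_addgt0Pr => delta delta0.
have mh : measurable_fun [set: 'rV[R]_n] (fun x => p x - p a)%R.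
  exact: measurable_funB.
have h0 x : (0 <= p x - p a)%R by rewrite subr_ge0.
have NM0 : (0 < n.+1%:R * M)%R by rewrite mulr_gt0// ltr0n.
have e10 : (0 < 2 * eta / (n.+1%:R * M))%R by rewrite divr_gt0// mulr_gt0.
have eta4 : (0 < 4 * eta)%R by rewrite mulr_gt0.
have [|e /andP[e0 ee1] small] := weighted_energy_small a v
  (fun x => p x - p a)%R M _ kappa k _ delta
  M0 eta4 kappa0 k1 e10 delta0 mv vM v2 vE mh h0 pint.
  by move=> x /pgrow; rewrite lerBlDl.
have vO x : v x != 0%R -> Omega (a + e *: x)%R.
  move=> /vM xM; apply: aO; rewrite /eball /=.
  apply: le_lt_trans (enorm_affine_le _ _ _ (ltW e0)) _.
  apply: (@le_lt_trans _ _ (2 * eta)%R); last by lra.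
  move: ee1; rewrite ler_pdivlMr//; apply: le_trans.
  by apply: ler_wpM2l; [exact: ltW|exact: ler_wpM2l].
have p_ge0 x : (0 <= p x)%R by apply: le_trans (pmin x); exact: ltW.
have [w [aw wE]] := rescale_admissible n s a e p v 1 Omega sn n0 e0 mp p_ge0 mv
  v2 vE ltr01 vq vO.
have Sw : S_s0 s Omega p <= energy s p w.
  by apply: ereal_inf_lbound; exists w.
apply: (le_trans Sw); rewrite wE powR1 mul1e.
have G0 := gagliardo_int_ge0 n s v.
have mG := measurable_gagliardo_int n s v mv.
have mhe : measurable_fun [set: 'rV[R]_n]
    (fun x => (p (a + e *: x) - p a)%:E)%R.
  apply/measurable_EFinP; apply: measurable_funB => //.
  by apply: measurableT_comp => //; exact: measurable_affine.
rewrite (eq_integral (fun x =>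
   (p a)%:E * (1%:E * \int[mu]_y (gagliardo s v x y)%:E) +
   (p (a + e *: x)%R - p a)%:E * \int[mu]_y (gagliardo s v x y)%:E)); last first.
  move=> x _; rewrite mul1e -ge0_muleDl ?lee_fin//.
  by rewrite -EFinD [(p a + _)%R]addrC subrK.
have mE : measurable_fun [set: 'rV[R]_n]
    (fun x => 1%:E * \int[mu]_y (gagliardo s v x y)%:E).
  exact: measurable_energy_density.
rewrite ge0_integralD//; last 4 first.
- by move=> x _; rewrite mul1e mule_ge0// lee_fin ltW.
- exact: measurable_funeM.
- by move=> x _; rewrite mule_ge0// lee_fin.
- exact: emeasurable_funM.
rewrite ge0_integralZl//; last 2 first.
- by move=> x _; rewrite mul1e.
- by rewrite lee_fin ltW.
by apply: leeD2l.
Qed.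

End transplantation.

(** * Two bumps have less energy than one *)

Section two_bumps.
Context {R : realType}.
Variables (n : nat) (s : R).
Hypothesis s0 : 0 < s.
Local Open Scope ereal_scope.
Local Notation mu := (lebn R n).
Local Notation q := (critical_exponent (n := n) s).
Implicit Types (u v w f g : 'rV[R]_n -> R) (x y a b : 'rV[R]_n).

(** For [f] and [g] with disjoint supports, this is minus the product of their
    increments, divided by the kernel of the seminorm. *)
Definition interaction f g (z : 'rV[R]_n * 'rV[R]_n) : R :=
  ((f z.1 * g z.2 + f z.2 * g z.1) * enorm (z.1 - z.2) `^ (- (n%:R + 2 * s)))%R.

Lemma measurable_interaction f g : measurable_fun [set: 'rV[R]_n] f ->
  measurable_fun [set: 'rV[R]_n] g ->
  measurable_fun setT (fun z => (interaction f g z)%:E).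
Proof.
move=> mf mg; apply/measurable_EFinP; apply: measurable_funM; last first.
  exact: measurable_enormB_powR.
have m1 (h : 'rV[R]_n -> R) : measurable_fun [set: 'rV[R]_n] h ->
    measurable_fun setT (fun z : 'rV[R]_n * 'rV[R]_n => h z.1).
  by move=> mh; exact: (measurableT_comp mh measurable_fst).
have m2 (h : 'rV[R]_n -> R) : measurable_fun [set: 'rV[R]_n] h ->
    measurable_fun setT (fun z : 'rV[R]_n * 'rV[R]_n => h z.2).
  by move=> mh; exact: (measurableT_comp mh measurable_snd).
by apply: measurable_funD; apply: measurable_funM; (exact: m1 || exact: m2).
Qed.

Lemma interaction_ge0 f g z : (forall x, (0 <= f x)%R) ->
  (forall x, (0 <= g x)%R) -> (0 <= interaction f g z)%R.
Proof.
by move=> f0 g0; rewrite mulr_ge0 ?powR_ge0// addr_ge0// mulr_ge0.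
Qed.

(** The energy is quadratic; the cross term is put on the left-hand side to
    stay within integrals of nonnegative functions. *)
Lemma energy1D f g (t : R) : (0 <= t)%R ->
  measurable_fun [set: 'rV[R]_n] f -> measurable_fun [set: 'rV[R]_n] g ->
  (forall x, (0 <= f x)%R) -> (forall x, (0 <= g x)%R) ->
  (forall x, (f x * g x = 0)%R) ->
  energy s (fun=> 1%R) (fun x => f x + t * g x)%R +
    (2 * t)%:E * \int[mu \x mu]_z (interaction f g z)%:E =
  energy s (fun=> 1%R) f + energy s (fun=> 1%R) (fun x => t * g x)%R.
Proof.
move=> t0 mf mg f0 g0 fg0.
have mtg : measurable_fun [set: 'rV[R]_n] (fun x => t * g x)%R.
  exact: measurable_funM.
have mftg : measurable_fun [set: 'rV[R]_n] (fun x => f x + t * g x)%R.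
  exact: measurable_funD.
have t20 : (0 <= 2 * t)%R by rewrite mulr_ge0.
have I0 z : 0 <= (interaction f g z)%:E by rewrite lee_fin interaction_ge0.
have mI := measurable_interaction f g mf mg.
have G0 u z : 0 <= (gagliardo s u z.1 z.2)%:E by rewrite lee_fin gagliardo_ge0.
rewrite !energy1E// -ge0_integralZl//.
rewrite -ge0_integralD//; last 3 first.
- exact: measurable_gagliardo.
- by move=> z _; rewrite mule_ge0.
- exact: measurable_funeM.
rewrite -ge0_integralD//; last 2 first.
- exact: measurable_gagliardo.
- exact: measurable_gagliardo.
apply: eq_integral => -[x y] _; rewrite -EFinM -!EFinD; congr EFin.
rewrite /interaction /gagliardo /= powRN !real_normK ?num_real//.
have fgx := fg0 x; have fgy := fg0 y.
set X := f x in fgx *; set Y := f y in fgy *.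
set X' := g x in fgx *; set Y' := g y in fgy *.
rewrite mulrA -!mulrDl; congr (_ / _)%R.
apply/eqP; rewrite -subr_eq0 (_ : _ - _ = 2 * t * (X * X' + Y * Y'))%R.
  by rewrite fgx fgy addr0 mulr0.
by ring.
Qed.

(** On the product of the two supports the kernel is at least [D^-(n+2s)], so
    the interaction dominates this constant times the product of the masses
    of [f] and [g], neither of which vanishes almost everywhere. *)
Lemma interaction_gt0 f g (D r : R) : (0 < D)%R -> (0 < r)%R ->
  measurable_fun [set: 'rV[R]_n] f -> measurable_fun [set: 'rV[R]_n] g ->
  (forall x, (0 <= f x)%R) -> (forall x, (0 <= g x)%R) ->
  (forall x y, f x != 0%R -> g y != 0%R -> (0 < enorm (x - y) <= D)%R) ->
  \int[mu]_x (`|f x| `^ r)%:E != 0 -> \int[mu]_x (`|g x| `^ r)%:E != 0 ->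
  0 < \int[mu \x mu]_z (interaction f g z)%:E.
Proof.
move=> D0 r0 mf mg f0 g0 fgD fr gr.
have int_gt0 (h : 'rV[R]_n -> R) : measurable_fun [set: 'rV[R]_n] h ->
    (forall x, (0 <= h x)%R) ->
    \int[mu]_x (`|h x| `^ r)%:E != 0 -> 0 < \int[mu]_x (h x)%:E.
  move=> mh h0 hr; rewrite lt_neqAle integral_ge0 ?andbT; last first.
    by move=> x _; rewrite lee_fin.
  rewrite eq_sym; apply: contra_neq hr => hint0.
  have mhE : measurable_fun [set: 'rV[R]_n] (EFin \o h) by exact/measurable_EFinP.
  have : \int[mu]_(x in setT) `|(EFin \o h) x| = 0.
    by rewrite -[RHS]hint0; apply: eq_integral => x _; rewrite gee0_abs// lee_fin.
  move/(ae_eq_integral_abs mu measurableT mhE) => h_ae.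
  rewrite -(integral0 mu setT); apply: ge0_ae_eq_integral => //.
    exact: measurable_normr_powR.
  by apply: filterS h_ae => x /= /(_ I) [->] _; rewrite normr0 powR0// gt_eqF.
have mfE : measurable_fun [set: 'rV[R]_n] (EFin \o f) by exact/measurable_EFinP.
have mgE : measurable_fun [set: 'rV[R]_n] (EFin \o g) by exact/measurable_EFinP.
pose C := (D `^ (- (n%:R + 2 * s)))%R.
have C0 : (0 < C)%R by exact: powR_gt0.
have mI := measurable_interaction f g mf mg.
have I0 z : 0 <= (interaction f g z)%:E by rewrite lee_fin interaction_ge0.
rewrite fubini_tonelli1//.
apply: (@lt_le_trans _ _ (C%:E * (\int[mu]_x (f x)%:E * \int[mu]_x (g x)%:E))).
  apply: mule_gt0; first by rewrite lte_fin.
  by apply: mule_gt0; [exact: int_gt0 mf f0 fr|exact: int_gt0 mg g0 gr].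
have ig0 : 0 <= \int[mu]_x (g x)%:E by apply: ltW; exact: int_gt0 mg g0 gr.
rewrite -ge0_integralZr//; last by move=> x _; rewrite lee_fin.
rewrite -ge0_integralZl//; last 3 first.
- by apply: emeasurable_funM => //; exact: measurable_cst.
- by move=> x _; rewrite mule_ge0// lee_fin.
- by rewrite lee_fin ltW.
apply: ge0_le_integral => //.
- by move=> x _; rewrite !mule_ge0// ?lee_fin// ltW.
- by apply: measurable_funeM; apply: emeasurable_funM => //; exact: measurable_cst.
- exact: (@measurable_fun_fubini_tonelli_F _ _ _ _ R mu _ mI).
move=> x _; rewrite muleA -EFinM -ge0_integralZl//; last 2 first.
- by move=> y _; rewrite lee_fin.
- by rewrite lee_fin mulr_ge0// ltW.
apply: ge0_le_integral => //.
- by move=> y _; rewrite -EFinM lee_fin !mulr_ge0// ltW.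
- exact: measurable_funeM.
- by move: mI => /measurable_fun_pair2; exact.
move=> y _; rewrite -EFinM lee_fin /interaction/=.
have [fx|fx] := eqVneq (f x) 0%R; first
  by rewrite fx mulr0 !mul0r add0r !mulr_ge0 ?powR_ge0.
have [gy|gy] := eqVneq (g y) 0%R; first
  by rewrite gy !mulr0 add0r !mulr_ge0 ?powR_ge0.
have /andP[xy0 xyD] := fgD _ _ fx gy.
rewrite -mulrA mulrC; apply: ler_pM.
- by rewrite mulr_ge0.
- exact: ltW.
- by rewrite lerDl mulr_ge0.
rewrite /C !powRN lef_pV2 ?posrE ?powR_gt0//.
apply: ge0_ler_powR; rewrite ?nnegrE ?enorm_ge0//; last exact: ltW.
by rewrite addr_ge0 ?ler0n// mulr_ge0// ltW.
Qed.

(** The competitor is [v + t g], where [g] is [v] translated by more than the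
    diameter of its support and [t] is small.  Disjointness makes the L^r
    integrals additive, so the L^q norm exceeds 1. *)
Lemma two_bumps v (M : R) : (0 < n)%N -> (2 * s < n%:R)%R -> (0 < M)%R ->
  measurable_fun [set: 'rV[R]_n] v -> (forall x, (0 <= v x)%R) ->
  (forall y, v y != 0%R -> (`|y| <= M)%R) ->
  \int[mu]_x (`|v x| `^ 2)%:E < +oo -> energy s (fun=> 1%R) v < +oo ->
  \int[mu]_x (`|v x| `^ q)%:E = 1 ->
  exists w (M' Q : R), [/\ (0 < M')%R /\ measurable_fun [set: 'rV[R]_n] w,
    (forall y, w y != 0%R -> (`|y| <= M')%R),
    \int[mu]_x (`|w x| `^ 2)%:E < +oo,
    (1 <= Q)%R /\ \int[mu]_x (`|w x| `^ q)%:E = Q%:E &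
    energy s (fun=> 1%R) w < energy s (fun=> 1%R) v].
Proof.
move=> n0 sn M0 mv v0 vM v2 vE vq.
have q0 : (0 < q)%R by rewrite divr_gt0 ?mulr_gt0 ?ltr0n// subr_gt0.
pose b : 'rV[R]_n := const_mx (2 * M + 1)%R.
have bM : (2 * M < `|b|)%R.
  have := normr_coord n b (Ordinal n0); rewrite mxE ger0_norm; lra.
pose g := rescale n b 1 1 v.
have gE x : g x = v (x - b)%R by rewrite /g /rescale invr1 scale1r mul1r.
have mg : measurable_fun [set: 'rV[R]_n] g by exact: measurable_rescale.
have g0 x : (0 <= g x)%R by rewrite gE.
have far x y : v x != 0%R -> g y != 0%R -> (`|b| - 2 * M <= `|x - y|)%R.
  rewrite gE => /vM xM /vM yM.
  rewrite lerBlDr [b in leLHS](_ : _ = x - (x - y) - (y - b))%R; last first.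
    by rewrite !opprB [(x + _)%R]addrC subrK [(y + _)%R]addrC subrK.
  have := ler_normB (x - (x - y))%R (y - b)%R.
  have := ler_normB x (x - y)%R.
  lra.
have near x y : v x != 0%R -> g y != 0%R -> (`|x - y| <= 2 * M + `|b|)%R.
  rewrite gE => /vM xM /vM yM.
  rewrite (_ : _ - _ = x - (y - b) - b)%R; last by rewrite opprB addrA addrAC addrK.
  have := ler_normB (x - (y - b)%R)%R b.
  have := ler_normB x (y - b)%R.
  lra.
pose D : R := (n%:R * (2 * M + `|b|))%R.
have D0 : (0 < D)%R by rewrite mulr_gt0 ?ltr0n//; have := normr_ge0 b; lra.
have vgD x y : v x != 0%R -> g y != 0%R -> (0 < enorm (x - y) <= D)%R.
  move=> vx gy; have lo := far _ _ vx gy; have up := near _ _ vx gy.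
  apply/andP; split.
    by apply: lt_le_trans (normr_le_enorm _ _); lra.
  by apply: le_trans (enorm_le_normr _ _) _; rewrite ler_wpM2l.
have vg0 x : (v x * g x = 0)%R.
  apply/eqP; rewrite mulf_eq0; apply: contrapT => /negP.
  rewrite negb_or => /andP[vx gx].
  by have := far _ _ vx gx; rewrite subrr normr0; lra.
have gtE t : rescale n b 1 t v = (fun x => t * g x)%R.
  by apply/funext => x; rewrite /g /rescale mul1r.
have int_g t r : \int[mu]_x (`|t * g x| `^ r)%:E =
    (`|t| `^ r)%:E * \int[mu]_x (`|v x| `^ r)%:E.
  have := integral_powR_rescale n b 1%R t v r ltr01 mv.
  by rewrite gtE expr1n mulr1.
have energy_g t : energy s (fun=> 1%R) (fun x => t * g x)%R =
    (t ^+ 2)%:E * energy s (fun=> 1%R) v.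
  rewrite -gtE (energy_rescale n s b 1%R t (fun=> 1%R) v ltr01 _ _ mv)//.
  by rewrite powR1 mulr1.
have int_w (t r : R) : (0 < t)%R -> (0 < r)%R ->
    \int[mu]_x (`|v x + t * g x| `^ r)%:E =
    (1 + `|t| `^ r)%:E * \int[mu]_x (`|v x| `^ r)%:E.
  move=> t0 r0; rewrite EFinD ge0_muleDl ?lee_fin ?powR_ge0//.
  rewrite mul1e -int_g -ge0_integralD//; last 2 first.
  - exact: measurable_normr_powR.
  - by apply: measurable_normr_powR; exact: measurable_funM.
  apply: eq_integral => x _; rewrite -EFinD; congr EFin.
  have rn0 : r != 0%R by rewrite gt_eqF.
  have /eqP := vg0 x; rewrite mulf_eq0 => /orP[] /eqP ->.
    by rewrite add0r normr0 powR0// add0r.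
  by rewrite mulr0 addr0 normr0 powR0// addr0.
have vq0 : \int[mu]_x (`|v x| `^ q)%:E != 0 by rewrite vq.
have gq0 : \int[mu]_x (`|g x| `^ q)%:E != 0.
  have := int_g 1%R q; rewrite normr1 powR1 mul1e vq => gq.
  under eq_integral => x _ do rewrite -[g x]mul1r.
  by rewrite gq.
have K0 := interaction_gt0 v g D q D0 q0 mv mg v0 g0 vgD vq0 gq0.
have [E E0 EE] := ge0_lty_EFin _ _
  (energy_ge0 n s _ v (fun=> ler01)) vE.
have w0 t : 0 <= energy s (fun=> 1%R) (fun x => v x + t * g x)%R.
  exact: energy_ge0.
(* The identity at [t = 1] also shows that the interaction is finite. *)
have [k k0 KE] : exists2 k : R, (0 < k)%R &
    \int[mu \x mu]_z (interaction v g z)%:E = k%:E.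
  have := energy1D v g 1%R ler01 mv mg v0 g0 vg0.
  rewrite energy_g EE -EFinM -EFinD; move: K0.
  case: (\int[mu \x mu]_z (interaction v g z)%:E) => [k k0 _|_|//].
    by exists k; rewrite -?lte_fin.
  rewrite gt0_muley ?lte_fin ?mulr1//; move: (w0 1%R).
  by case: (energy s _ (fun x => v x + _)%R).
(* The energy changes by [t * (t * E - 2 * k)], so [t * E < 2 * k] is needed. *)
pose t : R := (k / (E + 1))%R.
have t0 : (0 < t)%R by rewrite divr_gt0//; lra.
have tE : (t * E < 2 * k)%R.
  apply: (@le_lt_trans _ _ k); last by lra.
  rewrite /t mulrAC ler_pdivrMr; last by lra.
  by rewrite ler_wpM2l; [|exact: ltW|lra].
exists (fun x => v x + t * g x)%R, (M + `|b|)%R, (1 + t `^ q)%R; split.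
- split; first by have := normr_ge0 b; lra.
  by apply: measurable_funD => //; exact: measurable_funM.
- move=> y wy; have b0 := normr_ge0 b.
  have [vy|/vM] := eqVneq (v y) 0%R; last by lra.
  have : g y != 0%R by apply: contra_neq wy => ->; rewrite vy mulr0 addr0.
  rewrite gE => /vM yM; have := ler_normD (y - b)%R b; rewrite subrK; lra.
- by rewrite int_w// lte_mul_pinfty// lee_fin addr_ge0// powR_ge0.
- by rewrite int_w// vq mule1 (ger0_norm (ltW t0)) lerDl powR_ge0.
have := energy1D v g t (ltW t0) mv mg v0 g0 vg0.
rewrite energy_g EE KE -!EFinM -EFinD; move: (w0 t).
case: (energy s _ (fun x => v x + _)%R) => [Ew _|_|//].
  rewrite -EFinD => -[EwE]; rewrite lte_fin.
  have : (t * (t * E) < t * (2 * k))%R by rewrite ltr_pM2l.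
  by move: EwE; rewrite expr2; lra.
by rewrite addye.
Qed.

End two_bumps.

(** * Non-attainment and conclusion *)

Section nonattainment.
Context {R : realType}.
Variables (n : nat) (s : R).
Hypotheses (s0 : 0 < s) (n0 : (0 < n)%N) (sn : 2 * s < n%:R).
Local Open Scope ereal_scope.
Local Notation mu := (lebn R n).
Local Notation q := (critical_exponent (n := n) s).
Implicit Types (u v p : 'rV[R]_n -> R) (x y a : 'rV[R]_n).

(** The two-bump competitor of [two_bumps] may spread beyond [Omega], but
    rescaling brings it back into a ball contained in [Omega] at no cost. *)
Lemma energy1_not_minimal Omega a (M r : R) u :
  (0 < M)%R -> (forall x, Omega x -> (`|x| <= M)%R) ->
  (0 < r)%R -> eball a r `<=` Omega ->
  admissible s Omega u ->
  exists2 w, admissible s Omega w &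
    energy s (fun=> 1%R) w < energy s (fun=> 1%R) u.
Proof.
move=> M0 OM r0 aO au.
have q0 : (0 < q)%R by rewrite divr_gt0 ?mulr_gt0 ?ltr0n// subr_gt0.
have [_ _ _ uE] := admissible_data n s Omega u q0 au.
have [v [[mv v0] vO v2 vq vu]] := admissible_regular n s Omega u q0 au.
have vM y : v y != 0%R -> (`|y| <= M)%R by move=> /vO /OM.
have vE := le_lt_trans vu uE.
have [w [M' [Q [[M'0 mw] wM' w2 [Q1 wQ] wv]]]] :=
  two_bumps n s s0 v M n0 sn M0 mv v0 vM v2 vE vq.
have NM0 : (0 < n.+1%:R * M')%R by rewrite mulr_gt0// ltr0n.
pose e : R := (r / 2 / (n.+1%:R * M'))%R.
have e0 : (0 < e)%R by rewrite !divr_gt0.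
have wO x : w x != 0%R -> Omega (a + e *: x)%R.
  move=> /wM' xM'; apply: aO; rewrite /eball /=.
  apply: le_lt_trans (enorm_affine_le _ _ _ _ (ltW e0)) _.
  apply: (@le_lt_trans _ _ (e * (n.+1%:R * M'))%R).
    by apply: ler_wpM2l; [exact: ltW|exact: ler_wpM2l].
  by rewrite /e divfK ?gt_eqF//; lra.
have Q0 : (0 < Q)%R by lra.
have [z [az zE]] := rescale_admissible n s a e (fun=> 1%R) w Q Omega sn n0 e0
  (measurable_cst _) (fun=> ler01) mw w2 (lt_trans wv vE) Q0 wQ wO.
exists z; [exact: az|]; apply: le_lt_trans (lt_le_trans wv vu); rewrite zE.
(* Normalizing a function of L^q norm at least 1 does not raise its energy. *)
rewrite -[leRHS]mul1e; apply: lee_wpmul2r; first exact: energy_ge0.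
rewrite lee_fin -[leRHS](powRr0 Q); apply: ler_powR => //.
by rewrite mulNr oppr_le0 divr_ge0// ltW.
Qed.

End nonattainment.

Theorem proposition1p1 (R : realType) (n : nat) (s : R)
  (Omega : set 'rV[R]_n) (p : 'rV[R]_n -> R)
  (a : 'rV[R]_n) (p0 eta kappa k : R)
  (Omega_dom : smooth_bounded_domain Omega)
  (p_gt0 : forall x, 0 < p x)
  (p_cont : continuous p)
  (a_in : Omega a)
  (p0E : p0 = p a)
  (p0_min : forall x, p0 <= p x)
  (eta_gt0 : 0 < eta)
  (ball_sub : eball a (4 * eta) `<=` Omega)
  (kappa_gt0 : 0 < kappa)
  (k_gt1 : 1 < k)
  (p_growth : forall x, eball a (4 * eta) x ->
     p x <= p0 + kappa * enorm (x - a) `^ k)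
  (p_int : (lebn R n).-integrable [set: 'rV[R]_n] (fun x => (p x - p0)%:E))
  (ns : [\/ n = 3%N /\ 0 < s <= 1 / 4,
            n = 4%N /\ 0 < s <= 1 / 2,
            n = 5%N /\ 0 < s <= 3 / 4 |
            (6 <= n)%N /\ 0 < s < 1])
  (k_range : 2 <= k < n%:R - 4 * s) :
  [/\ (S_s0 s Omega p = p0%:E * S_s0 s Omega (fun=> 1%R))%E,
      ~ (exists u, minimizer s Omega p u) &
      ~ (exists u, minimizing_solution s Omega p u)].
Proof.
have [n2 /andP[s0 s1]] : (2 <= n)%N /\ 0 < s < 1.
  case: ns => -[]; [move=> ->|move=> ->|move=> ->|move=> n6];
    move=> /andP[s0 s1]; split => //; rewrite ?s0 ?s1//=; try lra.
  exact: leq_trans n6.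
have n0 : (0 < n)%N by exact: ltn_trans n2.
have sn : 2 * s < n%:R.
  apply: (@lt_le_trans _ _ 2); first by lra.
  by rewrite (ler_nat _ 2).
have eta4 : 0 < 4 * eta by lra.
have k1 : 1 <= k by exact: ltW.
have [M M0 OM] : exists2 M : R, 0 < M & forall x, Omega x -> `|x| <= M.
  have [_ _ _ [M0 [_ bM]] _] := Omega_dom.
  exists (Num.max M0 0 + 1).
    by rewrite ltr_wpDl// le_max lexx orbT.
  by apply: bM; rewrite ltr_pwDr// le_max lexx.
have [mh hint] := integrableP _ _ _ p_int.
have mp : measurable_fun [set: 'rV[R]_n] p.
  rewrite (_ : p = fun x => (p x - p0) + p0)%R.
    by apply: measurable_funD => //; exact/measurable_EFinP.
  by apply/funext => x; rewrite subrK.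
have p_ge0 x : 0 <= p x by exact: ltW.
have p00 : 0 < p0 by rewrite p0E.
have p00E : (0 <= p0%:E)%E by rewrite lee_fin ltW.
have q0 : 0 < critical_exponent (n := n) s.
  by rewrite divr_gt0 ?mulr_gt0 ?ltr0n// subr_gt0.
pose E (u : 'rV[R]_n -> R) := energy s (fun=> 1) u.
have lower u : admissible s Omega u -> (p0%:E * E u <= energy s p u)%E.
  move=> /(admissible_data n s Omega u q0)[mu_ _ _ _].
  rewrite /E /energy -ge0_integralZl//; last 2 first.
  - exact: measurable_energy_density.
  - by move=> x _; rewrite mul1e gagliardo_int_ge0.
  apply: ge0_le_integral => //.
  - by move=> x _; rewrite mul1e mule_ge0// gagliardo_int_ge0.
  - by apply: measurable_funeM; exact: measurable_energy_density.
  - exact: measurable_energy_density.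
  move=> x _; rewrite mul1e; apply: lee_wpmul2r; first exact: gagliardo_int_ge0.
  by rewrite lee_fin.
have upper u : admissible s Omega u -> (S_s0 s Omega p <= p0%:E * E u)%E.
  move=> au; have [_ _ _ uE] := admissible_data n s Omega u q0 au.
  have [v [[mv v0] vO v2 vq vu]] := admissible_regular n s Omega u q0 au.
  apply: le_trans (lee_wpmul2l p00E vu).
  have pint : (\int[lebn R n]_x (p x - p0)%:E < +oo)%E.
    apply: le_lt_trans hint; apply: ge0_le_integral => //.
    + by move=> x _; rewrite lee_fin subr_ge0.
    + exact: measurableT_comp.
    + by move=> x _; rewrite lee_abs.
  have vM y : v y != 0 -> `|y| <= M by move=> /vO /OM.
  subst p0; exact: (S_s0_le_transplant n s s0 Omega a p v eta kappa k M sn n0 mp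
    p00 p0_min pint eta_gt0 ball_sub kappa_gt0 k1 p_growth M0 mv vM v2
    (le_lt_trans vu uE) vq).
have SE : (S_s0 s Omega p = p0%:E * S_s0 s Omega (fun=> 1%R))%E.
  apply/eqP; rewrite eq_le; apply/andP; split.
    rewrite -lee_pdivrMl//; apply/ereal_infP => _ [u au <-].
    by rewrite lee_pdivrMl//; exact: upper.
  apply/ereal_infP => _ [u au <-].
  apply: le_trans (lower u au); apply: lee_wpmul2l => //.
  by apply: ereal_inf_lbound; exists u.
have no_min : ~ exists u, minimizer s Omega p u.
  move=> [u [au uS]].
  have [w aw wu] := energy1_not_minimal n s s0 n0 sn Omega a M (4 * eta) u
    M0 OM eta4 ball_sub au.
  have := lower u au; rewrite uS => /le_trans /(_ (upper w aw)).
  by rewrite lee_pmul2l// leNgt wu.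
split=> //; move=> [u [_ [c [_ cu]]]]; apply: no_min.
by exists (fun x => c * u x).
Qed.
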